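(* Let $p$ be a prime, $q=p^h$, $c\in\mathbb{F}_q$, and let $d$ be a positive integer with $p\nmid d(d-1)$. Let $s$ be the smallest positive integer such that $(d-1)\mid(p^s-1)$. Suppose that a $(d-1)$-th root $c_0\in\overline{\mathbb{F}_q}$ of $c$ (i.e. $c_0^{d-1}=c$) does not lie in $\mathbb{F}_{p^s}$. Then the plane curve $$\mathcal{D}_{f,c}:\ (X+1)^d-(Y+1)^d-c\,(X^d-Y^d)=0$$ has no singular points off the line $X=Y$.
   Context: Since $\mathbb{F}_{p^s}$ contains all $(d-1)$-th roots of unity, the condition on $c_0$ does not depend on the choice of the $(d-1)$-th root of $c$. *)

(* Defs.v *)
From HB Require Import structures.
From mathcomp Require Import all_boot all_order all_algebra all_field.
From mathcomp.multinomials Require Import mpoly.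

Set Implicit Arguments.
Unset Strict Implicit.
Unset Printing Implicit Defensive.

Import GRing.Theory.

Local Open Scope ring_scope.

(* Affine plane curves are given by polynomials in {mpoly F[2]}; variable 0
   is X and variable 1 is Y. *)
Definition curveD (F : nzRingType) (d : nat) (c : F) : {mpoly F[2]} :=
  let X : {mpoly F[2]} := 'X_(0 : 'I_2) in
  let Y : {mpoly F[2]} := 'X_(1 : 'I_2) in
  (X + 1) ^+ d - (Y + 1) ^+ d - c *: (X ^+ d - Y ^+ d).

(* The homogenizing variable comes last (index ord_max).  The total degree of
   a nonzero f is (msize f).-1. *)
Definition homogenize (n : nat) (R : nzRingType) (f : {mpoly R[n]}) :
    {mpoly R[n.+1]} :=
  \sum_(m <- msupp f)
    f@_m *: 'X_[(mnmwiden m + U_(ord_max) *+ ((msize f).-1 - mdeg m))%MM].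

(* For n = 2 this is an affine singular point; for n = 3, a homogeneous f and
   a nonzero v, v is a coordinate vector of a projective singular point. *)
Definition singular_at (n : nat) (K : comNzRingType) (f : {mpoly K[n]})
    (v : 'I_n -> K) : Prop :=
  f.@[v] = 0 /\ forall i : 'I_n, (f^`M(i)).@[v] = 0.

(* Homogeneous coordinates (x : y : z), the line at infinity being z = 0. *)
Definition proj_coords (K : nzRingType) (n : nat) (v : 'I_n -> K) : Prop :=
  exists i, v i != 0.

(* Main.v *)
Require Import Defs.
From HB Require Import structures.
From mathcomp Require Import all_boot all_order all_algebra all_field.
From mathcomp.multinomials Require Import ssrcomplements mpoly.
From mathcomp Require Import ring.

Set Implicit Arguments.
Unset Strict Implicit.
Unset Printing Implicit Defensive.

Import GRing.Theory.

Local Open Scope ring_scope.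

(* Since c0 is not in L, c is neither 0 nor 1, so the projective curve is
   (X + Z)^d - (Y + Z)^d = c (X^d - Y^d).  At a singular point (x : y : z) the
   derivatives in X and Y give (x + z)^(d-1) = c x^(d-1) and
   (y + z)^(d-1) = c y^(d-1); the derivative in Z (or, in the affine chart, the
   equation of the curve) then gives x^(d-1) = y^(d-1).  These three relations
   force x = y. *)

(** * Roots of unity and the image of the finite field [L] *)

Lemma expr_card_in_image (L : finFieldType) (K : fieldType)
    (j : {rmorphism L -> K}) (z : K) :
  z ^+ #|L| = z -> exists a, j a = z.
Proof.
(* Over [L], the polynomial X^|L| - X is the product of the X - a. Its image under [j] vanishes at
   [z], hence so does some factor X - [j a]. *)
move=> zq; have /(congr1 (map_poly j)) := finField_genPoly L.
rewrite rmorphB /= map_polyXn map_polyX rmorph_prod /=.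
move=> /(congr1 (horner^~ z)); rewrite !hornerE zq subrr horner_prod.
move/esym/eqP/prodf_eq0 => [a _].
by rewrite map_polyXsubC hornerXsubC subr_eq0 => /eqP->; exists a.
Qed.

(** Since [n] divides |L| - 1, an [n]-th root of unity satisfies z^|L| = z. *)
Lemma unity_root_in_image (L : finFieldType) (K : fieldType)
    (j : {rmorphism L -> K}) (n : nat) (z : K) :
  (n %| #|L| - 1)%N -> z ^+ n = 1 -> exists a, j a = z.
Proof.
move=> /dvdnP[m Dm] zn; apply: expr_card_in_image.
have /subnK <- : (0 < #|L|)%N by apply/card_gt0P; exists 0.
by rewrite Dm exprD mulnC exprM zn expr1n mul1r expr1.
Qed.

(* Up to n-th roots of unity, which lie in L, the three equations read
   x + z = c0 a x, y + z = c0 a' y and y = b x; eliminating z gives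
   1 - b = c0 (a - a' b), so that b = 1 because c0 is not in L. *)
Lemma equal_power_ratios (L : finFieldType) (K : fieldType)
    (j : {rmorphism L -> K}) (n : nat) (c0 x y z : K) :
  (0 < n)%N -> (n %| #|L| - 1)%N -> ~ (exists a, j a = c0) ->
  (x + z) ^+ n = c0 ^+ n * x ^+ n -> (y + z) ^+ n = c0 ^+ n * y ^+ n ->
  x ^+ n = y ^+ n -> x = y.
Proof.
move=> n_gt0 nL c0L xz yz xy.
have c0_neq0 : c0 != 0.
  by apply/eqP => c00; apply: c0L; exists 0; rewrite c00 rmorph0.
have [x0|x_neq0] := eqVneq x 0.
  move/eqP: xy; rewrite x0 expr0n eqn0Ngt n_gt0 eq_sym expf_eq0 n_gt0 /=.
  by move/eqP->.
have ratio w : w != 0 -> (w + z) ^+ n = c0 ^+ n * w ^+ n ->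
    exists a, w + z = c0 * j a * w.
  move=> w_neq0 wz.
  have [|a Da] := @unity_root_in_image L K j n ((w + z) / (c0 * w)) nL.
    by rewrite expr_div_n wz -exprMn divff // expf_neq0 // mulf_neq0.
  by exists a; rewrite Da; field; rewrite w_neq0.
have y_neq0 : y != 0.
  apply: contra_neq x_neq0 => y0; apply/eqP; move/eqP: xy.
  by rewrite y0 expr0n eqn0Ngt n_gt0 expf_eq0 n_gt0.
have [a Da] := ratio x x_neq0 xz.
have [a' Da'] := ratio y y_neq0 yz.
have [|b Db] := @unity_root_in_image L K j n (y / x) nL.
  by rewrite expr_div_n -xy divff // expf_neq0.
have Dy : y = j b * x by rewrite Db divfK.
have key : j (1 - b) = c0 * j (a - a' * b).
  apply: (mulIf x_neq0); rewrite !rmorphB rmorphM rmorph1 /=.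
  have -> : (1 - j b) * x = (x + z) - (y + z) by rewrite Dy; ring.
  by rewrite Da Da' Dy; ring.
(* If the coefficient of [c0] in [key] vanishes, then b = 1; otherwise solving for [c0] puts it in
   the image of [L]. *)
have [eab|nab] := eqVneq (a - a' * b) 0.
  move: key; rewrite eab rmorph0 mulr0 => /eqP.
  by rewrite fmorph_eq0 subr_eq0 => /eqP b1; rewrite Dy -b1 rmorph1 mul1r.
case: c0L; exists ((1 - b) / (a - a' * b)).
by rewrite fmorph_div key mulfK // fmorph_eq0.
Qed.

(** * Partial derivatives and homogenization *)

Local Notation widen := (widen_ord (leqnSn _)).

Lemma mderiv_exp (n : nat) (R : comNzRingType) (i : 'I_n) (p : {mpoly R[n]}) k :
  (p ^+ k)^`M(i) = (p ^+ k.-1 * p^`M(i)) *+ k.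
Proof.
case: k => [|k]; first by rewrite expr0 -[1]mpolyC1 mderivC mulr0n.
elim: k => [|k IHk]; first by rewrite expr1 mul1r.
rewrite exprS mderivM IHk /= mulrnAr mulrA -exprS [_ * p ^+ _]mulrC.
by rewrite [in RHS]mulrS.
Qed.

Lemma mderivXU (n : nat) (R : nzRingType) (i j : 'I_n) :
  ('X_i : {mpoly R[n]})^`M(j) = (i == j)%:R.
Proof.
rewrite mderivX mnm1E; case: eqVneq => [->|_]; last by rewrite scale0r.
by rewrite scale1r -{1}[U_(j)%MM]add0m addmK mpolyX0.
Qed.

(* Fixing the target degree D makes homogenization linear. *)
Definition homogenize_at (n D : nat) (R : nzRingType) (f : {mpoly R[n]}) :
    {mpoly R[n.+1]} :=
  \sum_(m : 'X_{1..n < D.+1})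
    f@_m *: 'X_[(mnmwiden m + U_(ord_max) *+ (D - mdeg m))%MM].

Lemma homogenize_at_is_linear (n D : nat) (R : nzRingType) :
  linear (@homogenize_at n D R).
Proof.
move=> a f g; rewrite /homogenize_at scaler_sumr -big_split /=.
by apply: eq_bigr => m _; rewrite mcoeffD mcoeffZ scalerDl scalerA.
Qed.

HB.instance Definition _ (n D : nat) (R : nzRingType) :=
  GRing.isLinear.Build R {mpoly R[n]} {mpoly R[n.+1]} _ (@homogenize_at n D R)
    (@homogenize_at_is_linear n D R).

Lemma homogenize_atE (n D : nat) (R : nzRingType) (f : {mpoly R[n]}) :
  msize f = D.+1 -> homogenize f = homogenize_at D f.
Proof.
move=> sf; rewrite /homogenize /homogenize_at sf /=.
(* The sum over the support becomes one over all monomials of degree at most [D]; the added terms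
   have coefficient zero. *)
rewrite (big_mksub 'X_{1..n < D.+1}) //=; first last.
- by move=> m /msize_mdeg_lt; rewrite sf.
- exact: msupp_uniq.
by rewrite big_rmcond //= => m; move/memN_msupp_eq0->; rewrite scale0r.
Qed.

Lemma homogenize_atX (n D : nat) (R : nzRingType) (m : 'X_{1..n}) :
  (mdeg m <= D)%N ->
  homogenize_at D ('X_[m] : {mpoly R[n]}) =
    'X_[(mnmwiden m + U_(ord_max) *+ (D - mdeg m))%MM].
Proof.
rewrite -ltnS => mD; rewrite /homogenize_at (bigD1 (BMultinom mD)) //=.
rewrite mcoeffX eqxx scale1r big1 ?addr0 // => m' nm.
rewrite mcoeffX; case: eqVneq => [e|]; last by rewrite scale0r.
by case/eqP: nm; apply: val_inj.
Qed.

Lemma homogenize_atXn (n D : nat) (R : nzRingType) (i : 'I_n) (k : nat) :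
  (k <= D)%N ->
  homogenize_at D ('X_i ^+ k : {mpoly R[n]}) =
    'X_(widen i) ^+ k * 'X_(ord_max) ^+ (D - k).
Proof.
move=> kD; rewrite mpolyXn homogenize_atX mdegMn mdeg1 mul1n //.
rewrite mpolyXD !mpolyXn; congr ('X_[_] * _).
by elim: k {kD} => [|k IHk]; rewrite ?mulm0n ?mnmwiden0 //
  !mulmS mnmwidenD IHk mnmwiden1.
Qed.

(** In the binomial expansion, the term of degree D - k receives the factor Z^k, where Z is the last
    variable; this is the expansion of (X_i + Z)^D. *)
Lemma homogenize_atXD1n (n D : nat) (R : nzRingType) (i : 'I_n) :
  homogenize_at D (('X_i + 1) ^+ D : {mpoly R[n]}) =
    ('X_(widen i) + 'X_ord_max) ^+ D.
Proof.
rewrite !exprDn_comm; first last.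
- exact: commr1.
- exact: commr_mpolyX.
rewrite raddf_sum; apply: eq_bigr => k _; rewrite expr1n mulr1 raddfMn /=.
by rewrite homogenize_atXn ?leq_subr // subKn // -ltnS.
Qed.

Lemma homogenize_at_curveD (R : nzRingType) (d : nat) (c : R) :
  homogenize_at d (curveD d c) =
    ('X_0 + 'X_ord_max) ^+ d - ('X_1 + 'X_ord_max) ^+ d
      - c *: ('X_0 ^+ d - 'X_1 ^+ d) :> {mpoly R[3]}.
Proof.
rewrite /curveD !linearB linearZ linearB /= !homogenize_atXD1n.
rewrite !homogenize_atXn //.
rewrite subnn !expr0 !mulr1.
have -> : widen (0 : 'I_2) = 0 :> 'I_3 by apply: val_inj.
by have -> : widen (1 : 'I_2) = 1 :> 'I_3 by apply: val_inj.
Qed.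

(** * The degree of the curve *)

Lemma msize_XD1n (n : nat) (R : nzRingType) (i : 'I_n) (d : nat) :
  (msize (('X_i + 1) ^+ d : {mpoly R[n]}) <= d.+1)%N.
Proof.
rewrite exprDn_comm; last exact: commr1.
apply: (big_ind (fun f : {mpoly R[n]} => (msize f <= d.+1)%N)).
- by rewrite msize0.
- by move=> f g fd gd; rewrite (leq_trans (msizeD_le _ _)) // geq_max fd.
move=> k _; rewrite expr1n mulr1 -scaler_nat (leq_trans (msizeZ_le _ _)) //.
by rewrite mpolyXn msizeX mdegMn mdeg1 mul1n ltnS leq_subr.
Qed.

Lemma mcoeff_XD1n (n : nat) (R : nzRingType) (i j : 'I_n) (d : nat) :
  (0 < d)%N ->
  (('X_i + 1) ^+ d : {mpoly R[n]})@_(U_(j) *+ d) = (i == j)%:R.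
Proof.
move=> d_gt0; have XnE k : ('X_i ^+ k : {mpoly R[n]})@_(U_(j) *+ d) =
    ((i == j) && (k == d))%:R.
  rewrite mcoeffXn; congr (nat_of_bool _)%:R.
  apply/eqP/andP => [e|[/eqP-> /eqP->] //].
  have /mnmP/(_ j) := e; rewrite !mulmnE !mnm1E eqxx mul1n => kd.
  (* If i and j differed, comparing the exponents at [j] would give d = 0. *)
  have ij : i == j by apply: contraTT d_gt0 => /negPf nij; rewrite -kd nij.
  by rewrite -kd ij mul1n.
rewrite exprDn_comm; last exact: commr1.
rewrite raddf_sum big_ord_recl /= big1 => [|k _].
  by rewrite subn0 expr1n mulr1 bin0 mulr1n XnE eqxx andbT addr0.
rewrite expr1n mulr1 mcoeffMn XnE /= andbC ltn_eqF ?mul0rn //.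
by rewrite /bump leq0n add1n ltn_subrL.
Qed.

(** The coefficient of X^d is 1 - c, so the degree is exactly [d] as soon as c differs from 1. *)
Lemma msize_curveD (R : nzRingType) (d : nat) (c : R) :
  (0 < d)%N -> c != 1 -> msize (curveD d c) = d.+1.
Proof.
move=> d_gt0 c_neq1; apply/eqP; rewrite eqn_leq; apply/andP; split.
  have leB (f g : {mpoly R[2]}) : (msize f <= d.+1)%N -> (msize g <= d.+1)%N ->
      (msize (f - g) <= d.+1)%N.
    by move=> fd gd; rewrite (leq_trans (msizeD_le _ _)) // geq_max fd msizeN.
  apply: (leB); first by apply: (leB); apply: msize_XD1n.
  rewrite (leq_trans (msizeZ_le _ _)) //.
  by apply: leB; rewrite mpolyXn msizeX mdegMn mdeg1 mul1n.
have -> : d = mdeg (U_(0 : 'I_2) *+ d) by rewrite mdegMn mdeg1 mul1n.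
apply: msize_mdeg_lt; rewrite mcoeff_msupp mdegMn mdeg1 mul1n.
rewrite /curveD !mcoeffB mcoeffZ mcoeffB !mcoeff_XD1n //= !mcoeffXn eqxx.
have /negPf-> : (U_(1%R : 'I_2) *+ d != U_(0%R : 'I_2) *+ d)%MM.
  apply/eqP => /mnmP/(_ (0%R : 'I_2)).
  rewrite !mulmnE !mnm1E /= mul0n mul1n => d0.
  by rewrite -d0 in d_gt0.
by rewrite !subr0 mulr1 subr_eq0 eq_sym.
Qed.

(* K is an algebraic closure of F (of order q = p ^ h), and j embeds the field
   L of order p ^ s in K. *)
Theorem theorem4p1 (p h : nat) (p_prime : prime p) (h_gt0 : (0 < h)%N)
    (F : finFieldType) (cardF : #|F| = (p ^ h)%N)
    (K : closedFieldType) (iota : {rmorphism F -> K})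
    (K_algebraic : integralRange iota)
    (c : F) (d : nat) (d_gt0 : (0 < d)%N) (p_ndvd : ~~ (p %| d * (d - 1))%N)
    (s : nat) (s_gt0 : (0 < s)%N) (s_dvd : (d - 1 %| p ^ s - 1)%N)
    (s_min : forall t : nat, (0 < t)%N -> (d - 1 %| p ^ t - 1)%N -> (s <= t)%N)
    (L : finFieldType) (cardL : #|L| = (p ^ s)%N) (j : {rmorphism L -> K})
    (c0 : K) (c0_root : c0 ^+ (d - 1) = iota c)
    (c0_notin : ~ exists x : L, j x = c0) :
  (forall v : 'I_2 -> K,
      singular_at (map_mpoly iota (curveD d c)) v -> v 0 = v 1) /\
  (forall v : 'I_3 -> K, proj_coords v ->
      singular_at (map_mpoly iota (homogenize (curveD d c))) v -> v 0 = v 1).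
Proof.
(* For d = 1 the product d(d - 1) would be 0, a multiple of [p]. *)
have d1_gt0 : (0 < d - 1)%N.
  by rewrite lt0n; apply: contra p_ndvd => /eqP->; rewrite muln0 dvdn0.
have d_neq0 : d%:R != 0 :> K.
  have pF := card_finPcharP cardF p_prime.
  rewrite -(rmorph_nat iota) fmorph_eq0 -(dvdn_pcharf pF).
  by apply: contra p_ndvd => /dvdn_mulr.
have c0_neq0 : c0 != 0.
  by apply/eqP => c00; apply: c0_notin; exists 0; rewrite c00 rmorph0.
have dL : (d - 1 %| #|L| - 1)%N by rewrite cardL.
have c_neq0 : iota c != 0 by rewrite -c0_root expf_neq0.
(* If c = 1, then [c0] is a (d-1)-th root of unity and so lies in the image of [L]. *)
have c_neq1 : c != 1.
  apply/eqP => c1; apply: c0_notin; apply: (@unity_root_in_image L K j _ c0 dL).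
  by rewrite c0_root c1 rmorph1.
have d_inj (e g : K) : e *+ d - g *+ d = 0 -> e = g.
  rewrite -mulrnBl -mulr_natl => /eqP.
  by rewrite mulf_eq0 (negPf d_neq0) subr_eq0 => /eqP.
have dxE (e g : K) : e ^+ d.-1 *+ d - iota c * (g ^+ d.-1 *+ d) = 0 ->
    e ^+ (d - 1) = c0 ^+ (d - 1) * g ^+ (d - 1).
  by rewrite c0_root subn1 mulrnAr => /d_inj.
(* The Y-derivative has the shape of the X-derivative with the opposite sign. *)
have dyE (e g : K) : e ^+ d.-1 *- d - iota c * (g ^+ d.-1 *- d) = 0 ->
    e ^+ (d - 1) = c0 ^+ (d - 1) * g ^+ (d - 1).
  by rewrite mulrN -opprD => /eqP; rewrite oppr_eq0 => /eqP/dxE.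
split=> v.
  rewrite /curveD !rmorphB !rmorphXn !rmorphD rmorph1 /= map_mpolyZ.
  rewrite rmorphB !rmorphXn /= !map_mpolyX.
  move=> [f0 df]; move: f0 (df 0) (df 1) => {df}.
  rewrite !(mderivB, mderivZ, mderiv_exp, mderivD, mderivXU).
  rewrite -[1]mpolyC1 !mderivC /=.
  rewrite !(addr0, mulr0, mulr1, subr0, mul0rn, sub0r).
  rewrite !(mevalB, mevalZ, mevalN, mevalMn, rmorphXn) /=.
  rewrite !(mevalB, mevalMn, rmorphXn, mevalD, mevalXU, mevalC) /=.
  move=> f0 /dxE fx /dyE fy.
  apply: (equal_power_ratios d1_gt0 dL c0_notin fx fy).
  (* Here z = 1. Substituting [fx] and [fy] into the equation of the curve leaves c(x^(d-1) -
     y^(d-1)) = 0. *)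
  have dS e : e ^+ d = e * e ^+ (d - 1) :> K by rewrite -exprS subn1 prednK.
  apply: (mulfI c_neq0); apply/eqP; rewrite -subr_eq0 -f0 !dS fx fy c0_root.
  by apply/eqP; ring.
move=> _; rewrite (homogenize_atE (msize_curveD d_gt0 c_neq1)).
rewrite homogenize_at_curveD.
rewrite !rmorphB !rmorphXn !rmorphD /= map_mpolyZ rmorphB !rmorphXn /=.
rewrite !map_mpolyX => -[_ df]; move: (df 0) (df 1) (df ord_max) => {df}.
rewrite !(mderivB, mderivZ, mderiv_exp, mderivD, mderivXU) /=.
rewrite !(addr0, add0r, mulr0, mulr1, subr0, mul0rn, sub0r).
rewrite !(mevalB, mevalZ, mevalN, mevalMn, rmorphXn) /=.
rewrite !(mevalB, mevalMn, rmorphXn, mevalD, mevalXU, mevalC) /=.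
(* The Z-derivative gives (x + z)^(d-1) = (y + z)^(d-1); by [fx] and [fy] both sides are c times
   x^(d-1) and y^(d-1), and c cancels. *)
move=> /dxE fx /dyE fy; rewrite oppr0 mulr0 subr0 => /d_inj fz.
apply: (equal_power_ratios d1_gt0 dL c0_notin fx fy).
by apply: (mulfI c_neq0); rewrite -c0_root -fx -fy subn1.
Qed.
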